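(* Let $k$ be an infinite field, $S=k[x_1,\ldots,x_n]$, and let $\mathcal I(\mathcal H)\subset S$ be the inclusion ideal associated to a uniformly increasing hypergraph $\mathcal H(\mathcal X,\mathcal E,d)$ on the $n$ vertices $\mathcal X=\{x_1,\ldots,x_n\}$. Let $\mathcal I^{[*]}(\mathcal H)$ be the special dual of $\mathcal I(\mathcal H)$. Then the set of associated primes $\operatorname{Ass}(S/\mathcal I^{[*]}(\mathcal H))$ is totally ordered by inclusion.
   Context: Uniformly increasing hypergraph: a triple $\mathcal H(\mathcal X,\mathcal E,d)$ where $\mathcal X=\{x_1,\ldots,x_n\}$ is a finite set, $d$ is a positive integer, and $\mathcal E=\{E_1,\ldots,E_s\}$ is a (nonempty) collection of subsets of $\mathcal X$ with $E_i\subseteq E_j$ for $1\le i<j\le s$, $|E_i|\ge 2$ for all $i$, and $|E_{i+1}|=|E_i|+d$ for $1\le i<s$. Containment vector: $a=(a_1,\ldots,a_n)\in\mathbb N^n$ with $a_j=|\{i\in\{1,\ldots,s\} : x_j\in E_i\}|$. Vertices are identified with the variables of $S$. Inclusion ideal: $\mathcal I(\mathcal H)=(x^{b_1},\ldots,x^{b_s})\subset S$, where $x^{b_i}=\prod_{x\in E_i}x^{\,s-i+1}$, i.e. $b_i\in\mathbb N^n$ has $j$-th coordinate $s-i+1$ if $x_j\in E_i$ and $0$ otherwise. These monomials are the minimal generators. For $c,b\in\mathbb N^n$ with $b\preceq c$ coordinatewise, $c\setminus b\in\mathbb N^n$ is the vector whose $j$-th coordinate is $c_j+1-b_j$ if $b_j\ge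 1$ and $0$ if $b_j=0$. For $v\in\mathbb N^n$, $m^{v}=(x_j^{v_j} : v_j\ge 1)\subset S$. Special dual: the Alexander dual of $\mathcal I(\mathcal H)$ with respect to the containment vector $a$, i.e. $\mathcal I^{[*]}(\mathcal H)=\bigcap_{i=1}^{s} m^{a\setminus b_i}$ (one has $b_i\preceq a$ for all $i$). *)

(* Defs.v *)
From mathcomp Require Import all_boot all_order all_algebra.
From mathcomp Require Export mpoly.

Set Implicit Arguments.
Unset Strict Implicit.
Unset Printing Implicit Defensive.

Import GRing.Theory.
Local Open Scope ring_scope.

Definition infinite_type (T : eqType) : Prop :=
  forall r : seq T, exists x : T, x \notin r.

Section Ideals.
Variable R : comNzRingType.

Definition is_ideal (I : R -> Prop) : Prop :=
  [/\ I 0,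
      forall x y, I x -> I y -> I (x + y)
    & forall r x, I x -> I (r * x)].

Definition is_prime_ideal (P : R -> Prop) : Prop :=
  [/\ is_ideal P, ~ P 1 & forall x y, P (x * y) -> P x \/ P y].

Definition ideal_gen (G : R -> Prop) (f : R) : Prop :=
  exists (r : nat) (c g : 'I_r -> R),
    (forall l, G (g l)) /\ f = \sum_(l < r) c l * g l.

(* [P] is in Ass(R/I): [P] is a prime ideal of the form Ann_R(f + I), where
   g * (f + I) = 0 in R/I means that g * f is in I. *)
Definition associated_prime (I P : R -> Prop) : Prop :=
  is_prime_ideal P /\ exists f : R, forall g : R, P g <-> I (g * f).

End Ideals.

(* The vertices x_1, ..., x_n and the edges E_1, ..., E_s are indexed from 0:
   [edge H i] is E_(i+1). *)
Record uihypergraph (n d : nat) := UIHypergraph {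
  nedges : nat;
  edge : 'I_nedges -> {set 'I_n};
  step_gt0 : (0 < d)%N;
  nedges_gt0 : (0 < nedges)%N;
  edge_subset : forall i j : 'I_nedges, (i < j)%N -> edge i \subset edge j;
  edge_card_ge2 : forall i : 'I_nedges, (2 <= #|edge i|)%N;
  edge_card_step : forall i j : 'I_nedges,
    j = i.+1 :> nat -> #|edge j| = (#|edge i| + d)%N
}.

Section MonomialIdeals.
Variables (k : fieldType) (n : nat).

(* The vector c \ b; it is only meaningful for b <= c coordinatewise. *)
Definition mnm_compl (c b : 'X_{1..n}) : 'X_{1..n} :=
  [multinom (if b j == 0%N then 0%N else (c j + 1 - b j)%N) | j < n].

Definition irreducible_ideal (v : 'X_{1..n}) : {mpoly k[n]} -> Prop :=
  ideal_gen (fun g => exists j : 'I_n, (1 <= v j)%N /\ g = 'X_j ^+ v j).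

Definition minimal_generator (I : {mpoly k[n]} -> Prop) (b : 'X_{1..n}) :
  Prop :=
  I 'X_[b] /\ forall c : 'X_{1..n}, (c <= b)%MM -> I 'X_[c] -> c = b.

(* The Alexander dual of a monomial ideal [I] with respect to [a]: the
   intersection of the ideals m^(a \ b), for x^b ranging over the minimal
   generators of [I]. *)
Definition alexander_dual (a : 'X_{1..n}) (I : {mpoly k[n]} -> Prop)
    (f : {mpoly k[n]}) : Prop :=
  forall b : 'X_{1..n},
    minimal_generator I b -> irreducible_ideal (mnm_compl a b) f.

End MonomialIdeals.

Section InclusionIdeals.
Variables (k : fieldType) (n d : nat) (H : uihypergraph n d).

Definition containment_vector : 'X_{1..n} :=
  [multinom #|[set i : 'I_(nedges H) | j \in edge i]| | j < n].

(* The exponent s - i + 1 of the 1-based index i is [nedges H - i] here. *)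
Definition inclusion_exponent (i : 'I_(nedges H)) : 'X_{1..n} :=
  [multinom (if j \in edge i then (nedges H - i)%N else 0%N) | j < n].

Definition inclusion_ideal : {mpoly k[n]} -> Prop :=
  ideal_gen (fun g => exists i : 'I_(nedges H), g = 'X_[inclusion_exponent i]).

Definition special_dual : {mpoly k[n]} -> Prop :=
  alexander_dual containment_vector inclusion_ideal.

End InclusionIdeals.

Arguments inclusion_ideal k {n d} H _.
Arguments special_dual k {n d} H _.

Section SpecialDual.
Variables (k : fieldType) (n d : nat) (H : uihypergraph n d).

Lemma inclusion_ideal_monomial (m : 'X_{1..n}) :
  inclusion_ideal k H 'X_[m] <->
  exists i : 'I_(nedges H), (inclusion_exponent i <= m)%MM.
Proof.
split=> [[r [c [g [Gg Xm]]]]|[i le_im]]; last first.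
  exists 1%N, (fun=> 'X_[m - inclusion_exponent i]),
    (fun=> 'X_[inclusion_exponent i]); split; first by exists i.
  by rewrite big_ord1 -mpolyXD submK.
have: \sum_(l < r) (c l * g l)@_m != 0.
  by rewrite -(raddf_sum (mcoeff m)) -Xm /= mcoeffX eqxx oner_neq0.
case: (pickP (fun l => (c l * g l)@_m != 0)) => [l nz_l _|z_l]; last first.
  by rewrite big1 ?eqxx // => l _; apply/eqP; have /negbFE := z_l l.
have [i gE] := Gg l; exists i; move: nz_l; rewrite gE -mcoeff_msupp.
by rewrite (perm_mem (msuppMX _ _)) => /mapP[m' _ ->]; apply: lem_addr.
Qed.

Lemma edge_card_ltn (i j : 'I_(nedges H)) :
  (i < j)%N -> (#|edge i| < #|edge j|)%N.
Proof.
case: j => j lt_js /=; elim: j lt_js => // j IHj lt_js; rewrite ltnS leq_eqVlt.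
have step : (#|edge (Ordinal (ltnW lt_js))| < #|edge (Ordinal lt_js)|)%N.
  rewrite (@edge_card_step _ _ H (Ordinal (ltnW lt_js)) (Ordinal lt_js) erefl).
  by rewrite -[X in (X < _)%N]addn0 ltn_add2l (step_gt0 H).
case/orP=> [/eqP eq_ij|/(IHj (ltnW lt_js)) lt_ij]; last exact: ltn_trans step.
by rewrite (_ : i = Ordinal (ltnW lt_js)) //; apply: val_inj.
Qed.

Lemma inclusion_exponent_antichain (i j : 'I_(nedges H)) :
  (inclusion_exponent i <= inclusion_exponent j)%MM -> i = j.
Proof.
move=> /mnm_lepP le_ij; apply: val_inj => /=; apply/eqP.
rewrite eqn_leq [X in X && _]leqNgt [X in _ && X]leqNgt.
have sub_ij x : x \in edge i ->
    (x \in edge j) && (nedges H - i <= nedges H - j)%N.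
  move=> xi; have := le_ij x; rewrite !mnmE xi; case: ifP => //= _.
  by rewrite leqn0 subn_eq0 leqNgt ltn_ord.
apply/andP; split; apply/negP => lt.
  have /subset_leq_card : edge i \subset edge j.
    by apply/subsetP => x /sub_ij /andP[].
  by rewrite leqNgt edge_card_ltn.
have /card_gt0P[x xi] : (0 < #|edge i|)%N.
  exact: leq_trans (edge_card_ge2 i).
by have /andP[_] := sub_ij _ xi; rewrite leqNgt ltn_sub2l.
Qed.

Lemma inclusion_minimal_generator (b : 'X_{1..n}) :
  minimal_generator (inclusion_ideal k H) b <->
  exists i : 'I_(nedges H), b = inclusion_exponent i.
Proof.
split=> [[/inclusion_ideal_monomial[i le_ib] min_b]|[i ->]].
  exists i; apply/esym/min_b => //; apply/inclusion_ideal_monomial.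
  by exists i; apply: lepm_refl.
split; first by apply/inclusion_ideal_monomial; exists i; apply: lepm_refl.
move=> c le_ci /inclusion_ideal_monomial[j le_jc].
have eq_ji := inclusion_exponent_antichain (lepm_trans le_jc le_ci).
apply/mnmP => x; apply/eqP; rewrite eqn_leq (mnm_lepP le_ci).
by rewrite -{1}eq_ji (mnm_lepP le_jc).
Qed.

Lemma special_dualE (f : {mpoly k[n]}) :
  special_dual k H f <->
  forall i : 'I_(nedges H),
    irreducible_ideal (mnm_compl (containment_vector H) (inclusion_exponent i))
      f.
Proof.
split=> [dual_f i|cap_f b /inclusion_minimal_generator[i ->]]; last exact: cap_f.
by apply: dual_f; apply/inclusion_minimal_generator; exists i.
Qed.

End SpecialDual.

(* Main.v *)
Require Import Defs.
From mathcomp Require Import all_boot all_order all_algebra.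

(** The dual is an intersection of irreducible monomial ideals [m^(v_i)], with
    [v_i] supported exactly on [E_i].  If [P = (I : f)] is prime, let [i] be the
    least index with [f] outside [m^(v_i)].  As [E_i] lies in every later edge, a
    large power of any variable of [E_i] lies in all the later components, so [P]
    contains the prime generated by [E_i].  Conversely a polynomial in the
    remaining variables is a nonzerodivisor modulo [m^(v_i)], so [P] is exactly
    that prime.  Nested edges generate nested primes. *)

Set Implicit Arguments.
Unset Strict Implicit.
Unset Printing Implicit Defensive.

Import GRing.Theory.
Local Open Scope ring_scope.

Section PrimeIdeals.
Variable R : comNzRingType.
Implicit Types I P G : R -> Prop.

Lemma ideal_gen_sub I G :
  is_ideal I -> (forall g, G g -> I g) -> forall f, ideal_gen G f -> I f.
Proof.
case=> I0 ID IM sGI f [r [c [g [Gg ->]]]].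
by elim/big_rec: _ => // l x _ Ix; apply: ID => //; apply: IM; apply: sGI.
Qed.

Lemma prime_ideal_exp P x e : is_prime_ideal P -> P (x ^+ e) -> P x.
Proof.
case=> _ P1 PM; elim: e => [/P1 //|e IHe].
by rewrite exprS => /PM[].
Qed.

End PrimeIdeals.

Section IrreducibleMonomialIdeals.
Variables (k : fieldType) (n : nat).
Implicit Types (f g h : {mpoly k[n]}) (u v m : 'X_{1..n}).

Definition mnm_in_irreducible v m :=
  [exists j : 'I_n, (0 < v j)%N && (v j <= m j)%N].

Lemma mnm_in_irreducible_le v m m' :
  (m <= m')%MM -> mnm_in_irreducible v m -> mnm_in_irreducible v m'.
Proof.
move=> /mnm_lepP le_mm' /existsP[j /andP[v_gt0 le_vm]].
by apply/existsP; exists j; rewrite v_gt0 (leq_trans le_vm).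
Qed.

(** If each monomial of [f] passes the test, choosing a generator that divides it writes [f] term by
    term as a combination of generators. Conversely, each monomial of a sum of multiples of pure
    powers occurs in some summand, hence is divisible by that power. Membership thus becomes a
    boolean test on the support. *)
Lemma irreducible_idealP v f :
  reflect (irreducible_ideal v f) (all (mnm_in_irreducible v) (msupp f)).
Proof.
apply: (iffP allP) => [sup_f|[r [c [g [Gg ->]]]] m].
  have /fin_all_exists[j jP] (l : 'I_(size (msupp f))) :
      exists j, (0 < v j)%N && (v j <= (nth 0%MM (msupp f) l) j)%N.
    by apply/existsP/sup_f/mem_nth.
  pose mon (l : 'I_(size (msupp f))) := nth 0%MM (msupp f) l.
  exists (size (msupp f)),
    (fun l => f@_(mon l) *: 'X_[mon l - (U_(j l) *+ v (j l))%MM]),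
    (fun l => 'X_(j l) ^+ v (j l)); split=> [l|].
    by exists (j l); have /andP[] := jP l.
  rewrite {1}[f]mpolyE (big_nth 0%MM) big_mkord; apply: eq_bigr => l _.
  rewrite -scalerAl mpolyXn -mpolyXD submK //; apply/mnm_lepP => x.
  rewrite mulmnE mnm1E; have /andP[_] := jP l.
  by case: eqP => [->|_]; rewrite ?mul1n // mul0n.
rewrite mcoeff_msupp raddf_sum /= => nz.
case: (pickP (fun l => (c l * g l)@_m != 0)) => [l|z_l]; last first.
  by case/eqP: nz; apply: big1 => l _; apply/eqP; have /negbFE := z_l l.
have [j [v_gt0 ->]] := Gg l; rewrite mpolyXn -mcoeff_msupp.
rewrite (perm_mem (msuppMX _ _)) => /mapP[m' _ ->].
apply/existsP; exists j; rewrite v_gt0 /= mnmDE mulmnE mnm1E eqxx mul1n.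
exact: leq_addr.
Qed.

Lemma irreducible_ideal_is_ideal v : is_ideal (@irreducible_ideal k n v).
Proof.
split=> [|f g /irreducible_idealP/allP vf /irreducible_idealP/allP vg
        |g f /irreducible_idealP/allP vf]; apply/irreducible_idealP/allP => m.
- by rewrite msupp0.
- by move/msuppD_le; rewrite mem_cat => /orP[/vf|/vg].
- move/msuppM_le => /allpairsP[[m1 m2] /= [_ /vf vm2 ->]].
  exact: mnm_in_irreducible_le (lem_addl _ _) vm2.
Qed.

(** The normal form of [f] modulo the monomial ideal m^v. *)
Definition standard_part v f : {mpoly k[n]} :=
  \sum_(m <- msupp f | ~~ mnm_in_irreducible v m) f@_m *: 'X_[m].

Lemma standard_part_supp v f m :
  m \in msupp (standard_part v f) -> ~~ mnm_in_irreducible v m.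
Proof.
rewrite /standard_part mcoeff_msupp raddf_sum /=; apply: contraR.
move/negPn => vm; apply/eqP/big1 => m' vm'; rewrite mcoeffZ mcoeffX.
by case: eqP vm' => [->|_ _]; rewrite ?vm // mulr0.
Qed.

Lemma standard_part_decomp v f :
  exists2 h, irreducible_ideal v h & f = h + standard_part v f.
Proof.
have [v0 vD vM] := irreducible_ideal_is_ideal v.
exists (\sum_(m <- msupp f | mnm_in_irreducible v m) f@_m *: 'X_[m]).
  elim/big_rec: _ => // m h vm vh; apply: vD => //; rewrite -mul_mpolyC.
  apply: vM; apply/irreducible_idealP/allP => m'.
  by rewrite msuppX inE => /eqP->.
by rewrite {1}[f]mpolyE (bigID (mnm_in_irreducible v)).
Qed.

(** Its irreducible ideal is the radical of m^v, generated by the variables in the support of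
    [v]. *)
Definition radical_exponent v : 'X_{1..n} :=
  [multinom nat_of_bool (0 < v j)%N | j < n].

Lemma irreducible_ideal_radical_sub u v f :
    (forall j, (0 < u j)%N -> (0 < v j)%N) ->
  irreducible_ideal (radical_exponent u) f ->
  irreducible_ideal (radical_exponent v) f.
Proof.
move=> suv /irreducible_idealP/allP uf; apply/irreducible_idealP/allP.
move=> m /uf /existsP[j]; rewrite mnmE; case u_gt0: (0 < u j)%N => //= m_gt0.
by apply/existsP; exists j; rewrite mnmE suv.
Qed.

(** No variable of the support of [v] occurs in [g], so multiplying by a monomial of [g] keeps
    standard monomials standard. The product of [g] with the standard part of [f] is therefore both
    standard and in m^v, hence zero, and polynomials over a field form a domain. *)
Lemma standard_nonzerodivisor v g f :
    {in msupp g, forall m, ~~ mnm_in_irreducible (radical_exponent v) m} ->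
    g != 0 ->
  irreducible_ideal v (g * f) -> irreducible_ideal v f.
Proof.
move=> std_g nz_g; have [v0 vD vM] := irreducible_ideal_is_ideal v.
have [h vh fE] := standard_part_decomp v f; rewrite fE mulrDr => vgf.
suff -> : standard_part v f = 0 by rewrite addr0.
apply/eqP; suff: g * standard_part v f == 0.
  by rewrite mulf_eq0 (negPf nz_g).
have vgs : irreducible_ideal v (g * standard_part v f).
  rewrite -[X in irreducible_ideal v X](addKr (g * h)) addrC.
  by apply: vD => //; rewrite -mulNr; apply: vM.
rewrite -msupp_eq0; case: (msupp _) (@msuppM_le _ _ g (standard_part v f))
  (introT (irreducible_idealP _ _) vgs) => // m s sup_s /andP[vm _].
have /allpairsP[[m1 m2] /= [gm1 sm2 mE]] := sup_s m (mem_head _ _).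
case/negP: (standard_part_supp sm2).
case/existsP: vm => j /andP[v_gt0 le_vm]; apply/existsP; exists j.
rewrite v_gt0; suff m1j0 : m1 j = 0%N by rewrite mE mnmDE m1j0 in le_vm.
apply/eqP; rewrite -leqn0 leqNgt; apply: contra (std_g _ gm1) => m1_gt0.
by apply/existsP; exists j; rewrite mnmE v_gt0.
Qed.

Lemma associated_prime_nested_irreducible s (v : 'I_s -> 'X_{1..n})
    (I P : {mpoly k[n]} -> Prop) :
    (forall (i j : 'I_s) x, (i <= j)%N -> (0 < v i x)%N -> (0 < v j x)%N) ->
    (forall f, I f <-> forall i, irreducible_ideal (v i) f) ->
    associated_prime I P ->
  exists i, forall g, P g <-> irreducible_ideal (radical_exponent (v i)) g.
Proof.
move=> nested IE [primeP [f Pf]]; have [idealP P1 _] := primeP.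
have [P0 PD PM] := idealP.
pose out i := ~~ all (mnm_in_irreducible (v i)) (msupp f).
(* Otherwise [f] lies in [I], so 1 lies in [P]. *)
have [i0 out_i0] : exists i, out i.
  apply/existsP; rewrite -[X in is_true X]negbK negb_exists; apply/negP.
  move/forallP => in_f; apply/P1/Pf/IE => i; rewrite mul1r.
  by apply/irreducible_idealP; have /negPn := in_f i.
case: (arg_minnP (fun i : 'I_s => i : nat) out_i0) => i out_i min_i.
have sub_radP g : irreducible_ideal (radical_exponent (v i)) g -> P g.
  apply: ideal_gen_sub idealP _ g => _ [x [rad_gt0 ->]].
  have v_gt0 : (0 < v i x)%N by move: rad_gt0; rewrite mnmE lt0b.
  rewrite mnmE v_gt0 expr1.
  (* The sum bounds every [v j x], so a single power of the variable serves all components from [i]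
     on; the earlier ones contain [f] by minimality of [i]. *)
  apply: (@prime_ideal_exp _ _ _ (\sum_j v j x)%N primeP).
  apply/Pf/IE => j; have [v0 vD vM] := irreducible_ideal_is_ideal (v j).
  have [le_ij|lt_ji] := leqP i j; last first.
    apply: vM; apply/irreducible_idealP; apply: contraLR lt_ji => out_j.
    by rewrite -leqNgt min_i.
  rewrite mulrC; apply: vM; apply/irreducible_idealP/allP => m.
  rewrite mpolyXn msuppX inE => /eqP->; apply/existsP; exists x.
  rewrite (nested i) //= mulmnE mnm1E eqxx mul1n.
  by rewrite (bigD1 j) //= leq_addr.
exists i => g; split=> [Pg|]; last exact: sub_radP.
have [h rad_h gE] := standard_part_decomp (radical_exponent (v i)) g.
set g0 := standard_part _ g in gE.
(* The remainder [g0] is again in [P]; were it nonzero, it could be cancelled from [g0 * f], putting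
   [f] in the component [i]. *)
suff /eqP g00 : g0 == 0 by rewrite gE g00 addr0.
apply: contraNT out_i => nz_g0; apply/irreducible_idealP.
apply: (standard_nonzerodivisor (g := g0)) => //.
  by move=> m; apply: standard_part_supp.
suff /Pf/IE : P g0 by apply.
rewrite -[g0](addKr h) -gE; apply: PD => //.
by rewrite -mulN1r; apply: PM; apply: sub_radP.
Qed.

End IrreducibleMonomialIdeals.

Section Hypergraph.
Variables (n d : nat) (H : uihypergraph n d).

(** By nesting, [x] lies in every edge from index [i] on, and there are [nedges H - i] of them. *)
Lemma inclusion_exponent_le_containment (i : 'I_(nedges H)) x :
  x \in edge i -> (nedges H - i <= containment_vector H x)%N.
Proof.
move=> xi; rewrite mnmE.
have -> : (nedges H - i)%N = #|[set l : 'I_(nedges H) | (i <= l)%N]|.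
  rewrite cardsE -sum1_card -(big_mkord (fun l => (i <= l)%N) (fun=> 1%N)).
  rewrite (big_cat_nat (n := i)) ?(ltnW (ltn_ord i)) //=.
  rewrite big_nat_cond big_pred0 ?add0n => [|l]; last first.
    by rewrite leq0n /= [(i <= l)%N]leqNgt; case: (l < i)%N.
  rewrite big_nat_cond (eq_bigl (fun l => (i <= l < nedges H)%N && true)).
    by rewrite -big_nat_cond sum_nat_const_nat muln1.
  by move=> l; case: (i <= l)%N; rewrite // !andbT.
apply/subset_leq_card/subsetP => l; rewrite !inE leq_eqVlt.
case/orP=> [/eqP/val_inj <- //|lt_il].
exact: (subsetP (edge_subset lt_il)).
Qed.

Lemma dual_exponent_gt0 (i : 'I_(nedges H)) x :
  (0 < mnm_compl (containment_vector H) (inclusion_exponent i) x)%N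
    = (x \in edge i).
Proof.
rewrite [mnm_compl _ _ _]mnmE [inclusion_exponent _ _]mnmE.
case xi: (x \in edge i) => //.
(* The zero branch of [mnm_compl] is excluded by [i < nedges H]; positivity of the truncated
   difference is then the bound by the containment vector. *)
rewrite -if_neg -lt0n subn_gt0 ltn_ord subn_gt0 addn1 ltnS.
exact: inclusion_exponent_le_containment.
Qed.

End Hypergraph.

Theorem proposition2p12 (k : fieldType) (k_infinite : infinite_type k)
    (n d : nat) (H : uihypergraph n d) (P Q : {mpoly k[n]} -> Prop) :
  associated_prime (special_dual k H) P ->
  associated_prime (special_dual k H) Q ->
  (forall f, P f -> Q f) \/ (forall f, Q f -> P f).
Proof.
pose v (i : 'I_(nedges H)) :=
  mnm_compl (containment_vector H) (inclusion_exponent i).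
have nested (i j : 'I_(nedges H)) x :
    (i <= j)%N -> (0 < v i x)%N -> (0 < v j x)%N.
  rewrite !dual_exponent_gt0 leq_eqVlt => /orP[/eqP/val_inj-> //|lt_ij].
  exact: (subsetP (edge_subset lt_ij)).
have assE :=
  associated_prime_nested_irreducible nested (@special_dualE k n d H).
move=> /assE[i Pi] /assE[j Qj].
have [le_ij|/ltnW le_ji] := leqP i j; [left|right] => f.
  move=> /Pi Pf; apply/Qj; apply: irreducible_ideal_radical_sub Pf => x.
  exact: nested.
move=> /Qj Qf; apply/Pi; apply: irreducible_ideal_radical_sub Qf => x.
exact: nested.
Qed.
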